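(* Let $G$ be a non-elementary word-hyperbolic group and let $X$ be a finite generating set for $G$. Then there exist real constants $\lambda > 1$ and $D > 1$ such that \[ D^{-1}\lambda^n \leq \mathfrak{B}_{G,X}(n) \leq D\lambda^n \] for all integers $n \geq 0$.
   Context: For a group $G$ with a finite generating set $X$ and an integer $n \geq 0$, $S_{G,X}(n) \subseteq G$ denotes the sphere of radius $n$, i.e. the set of elements $g \in G$ whose word length with respect to $X$ (the minimal number of letters in a word over $X^{\pm 1} = X \cup X^{-1}$ representing $g$) is exactly $n$. The ball of radius $n$ is $B_{G,X}(n) = \bigcup_{i=0}^n S_{G,X}(i)$, and $\mathfrak{B}_{G,X}(n) = |B_{G,X}(n)|$ is its cardinality. A word-hyperbolic group is non-elementary if it is not virtually cyclic (in particular it is infinite). *)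

(* Defs.v *)
From HB Require Import structures.
From mathcomp Require Import all_boot all_order all_algebra finmap.
From mathcomp Require Import all_classical reals.

Set Implicit Arguments.
Unset Strict Implicit.
Unset Printing Implicit Defensive.

Import Order.TTheory GRing.Theory Num.Theory.

Local Open Scope classical_set_scope.
Local Open Scope ring_scope.

Section WordMetric.
Variables (G : groupType) (X : set G).

Definition letters : set G := X `|` [set a^-1%g | a in X].

Definition spelled (g : G) (n : nat) : Prop :=
  exists w : seq G,
    [/\ [set` w] `<=` letters, (\prod_(a <- w) a)%g = g & size w = n].

Definition generates : Prop := forall g, exists n, spelled g n.

(* The default value 0 is taken only at elements outside the subgroup
   generated by X; it never occurs when X generates G. *)
Definition word_length (g : G) : nat :=
  xget 0%N [set n | spelled g n /\ forall m, spelled g m -> (n <= m)%N].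

Definition word_sphere (n : nat) : set G := [set g | word_length g = n].

Definition word_ball (n : nat) : set G :=
  \bigcup_(i in [set i | (i <= n)%N]) word_sphere i.

(* fset_set returns the empty set on infinite sets; balls are finite as soon
   as X is finite and generates G. *)
Definition ball_growth (n : nat) : nat := #|` fset_set (word_ball n) |%fset.

Definition word_dist (x y : G) : nat := word_length (x^-1 * y)%g.

End WordMetric.

Section Hyperbolicity.
Variable R : realType.

Definition gromov_product (T : Type) (d : T -> T -> R) (w x y : T) : R :=
  (d x w + d y w - d x y) / 2.

Definition gromov_hyperbolic (T : Type) (d : T -> T -> R) : Prop :=
  exists delta : R, forall w x y z : T,
    Num.min (gromov_product d w x z) (gromov_product d w z y) - delta
      <= gromov_product d w x y.

(* Gromov's definition: some word metric of G is hyperbolic. *)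
Definition hyperbolic_group (G : groupType) : Prop :=
  exists Y : set G, [/\ finite_set Y, generates Y
    & gromov_hyperbolic (fun x y => (word_dist Y x y)%:R)].

End Hyperbolicity.

Section VirtuallyCyclic.
Variable G : groupType.

Definition cyclic_subgroup (g : G) : set G :=
  [set h | exists n : nat, h = (g ^+ n)%g \/ h = (g ^- n)%g].

Definition finite_index (H : set G) : Prop :=
  finite_set [set [set (x * h)%g | h in H] | x in [set: G]].

Definition virtually_cyclic : Prop :=
  exists g : G, finite_index (cyclic_subgroup g).

End VirtuallyCyclic.

Arguments virtually_cyclic G : clear implicits.

(* Main.v *)
(**
Two word metrics are used: d_Y, which is hyperbolic, and d_X, whose balls are
counted. If no bounded turn [f] could make the Gromov product of [a] and [f h]
small, then all short elements would move some far away [h] in the same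
direction as [h] itself; a point [g] on a geodesic from 1 to [h] is then
loxodromic, the generators displace its powers by a bounded amount, and the
pigeonhole principle produces a central power of [g], so that G is virtually
cyclic. Hence [g] and [h] can always be concatenated, through a bounded [f],
into an almost d_Y-geodesic product [g f h], which by the Morse lemma is almost
d_X-geodesic too, so that [g] can be recovered from the product up to bounded
error. Sphere cardinalities are therefore supermultiplicative up to constants,
while ball cardinalities are submultiplicative, and
lambda = inf_n b(n)^(1/n) controls both. If lambda were 1 the growth would be
linear, and an element of infinite order would generate a subgroup of finite
index, because its cosets occupy linearly many points each.
*)
Require Import Defs.
From HB Require Import structures.
From mathcomp Require Import all_boot all_order all_algebra finmap zify ring lra.
From mathcomp Require Import all_classical reals sequences exp.

Set Implicit Arguments.
Unset Strict Implicit.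
Unset Printing Implicit Defensive.

Import Order.TTheory GRing.Theory Num.Theory.

Local Open Scope classical_set_scope.

(** * Word lengths, geodesics and finiteness of balls *)

Section WordLength.
Variables (G : groupType) (X : set G).

Lemma spelledM g h m n :
  spelled X g m -> spelled X h n -> spelled X (g * h)%g (m + n).
Proof.
move=> [v [vX <- <-]] [w [wX <- <-]]; exists (v ++ w); split.
- move=> a /=; rewrite mem_cat => /orP[/vX//|/wX//].
- by rewrite big_cat.
- by rewrite size_cat.
Qed.

Lemma lettersV a : letters X a -> letters X a^-1%g.
Proof.
case=> [Xa|[b Xb <-]]; first by right; exists a.
by left; rewrite invgK.
Qed.

Lemma spelledV g n : spelled X g n -> spelled X g^-1%g n.
Proof.
move=> [w [wX <- <-]]; elim: w wX => [|a w IH] wX.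
  by exists [::]; split => //; rewrite big_nil invg1.
rewrite big_cons invgM /= -addn1; apply: spelledM.
  by apply: IH => b bw; apply: wX; rewrite /= inE bw orbT.
exists [:: a^-1%g]; split => //; last by rewrite big_seq1.
move=> b /=; rewrite inE => /eqP ->; apply: lettersV.
by apply: wX; rewrite /= mem_head.
Qed.

Hypothesis Xgen : generates X.

Lemma word_lengthP g :
  spelled X g (word_length X g) /\
  forall m, spelled X g m -> (word_length X g <= m)%N.
Proof.
rewrite /word_length; case: xgetP => [n _ //|none].
have exP : exists n, `[< spelled X g n >].
  by have [n gn] := Xgen g; exists n; apply/asboolP.
case: (ex_minnP exP) => n /asboolP gn nmin.
by case: (none n); split=> // m /asboolP; apply: nmin.
Qed.

Lemma spelled_word_length g : spelled X g (word_length X g).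
Proof. by case: (word_lengthP g). Qed.

Lemma word_length_le g n : spelled X g n -> (word_length X g <= n)%N.
Proof. by case: (word_lengthP g) => _; apply. Qed.

Lemma spelled1 : spelled X 1%g 0.
Proof. by exists [::]; split => //; rewrite big_nil. Qed.

Lemma word_length1 : word_length X 1%g = 0%N.
Proof. by apply/eqP; rewrite -leqn0; apply: word_length_le; apply: spelled1. Qed.

Lemma word_length_eq0 g : word_length X g = 0%N -> g = 1%g.
Proof.
move=> g0; have := spelled_word_length g; rewrite g0 => -[w [_ <- /size0nil->]].
by rewrite big_nil.
Qed.

Lemma word_lengthV g : word_length X g^-1%g = word_length X g.
Proof.
apply/eqP; rewrite eqn_leq; apply/andP; split.
  by apply/word_length_le/spelledV/spelled_word_length.
rewrite -{1}[g]invgK.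
by apply/word_length_le/spelledV/spelled_word_length.
Qed.

Lemma word_lengthM g h :
  (word_length X (g * h)%g <= word_length X g + word_length X h)%N.
Proof. by apply/word_length_le/spelledM; exact: spelled_word_length. Qed.

Lemma word_distxx x : word_dist X x x = 0%N.
Proof. by rewrite /word_dist mulVg word_length1. Qed.

Lemma word_distC x y : word_dist X x y = word_dist X y x.
Proof. by rewrite /word_dist -word_lengthV invgM invgK. Qed.

Lemma word_dist_tri y x z :
  (word_dist X x z <= word_dist X x y + word_dist X y z)%N.
Proof.
by rewrite /word_dist; have := word_lengthM (x^-1 * y)%g (y^-1 * z)%g;
  rewrite mulgA mulgK.
Qed.

Lemma word_distM g x y : word_dist X (g * x)%g (g * y)%g = word_dist X x y.
Proof. by rewrite /word_dist invgM -mulgA mulKg. Qed.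

Lemma word_dist1 x : word_dist X 1%g x = word_length X x.
Proof. by rewrite /word_dist invg1 mul1g. Qed.

Lemma word_dist_mulr x s : word_dist X x (x * s)%g = word_length X s.
Proof. by rewrite /word_dist mulKg. Qed.

(** The path runs through the prefix products of a shortest word. Subwords bound the distances along
    it from above, and the triangle inequality turns these bounds into equalities because the
    endpoints are at the full distance. *)
Lemma word_geodesic x y : exists r : nat -> G,
  [/\ r 0%N = x, r (word_dist X x y) = y &
    forall i j, (i <= j <= word_dist X x y)%N -> word_dist X (r i) (r j) = (j - i)%N].
Proof.
have [w [wX wP wn]] := spelled_word_length (x^-1 * y)%g.
rewrite -/(word_dist X x y) in wn *; set n := word_dist X x y in wn *.
pose r i := (x * \prod_(a <- take i w) a)%g.
have r0 : r 0%N = x by rewrite /r take0 big_nil mulg1.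
have rn : r n = y by rewrite /r -wn take_size wP mulVKg.
have le i j : (i <= j <= n)%N -> (word_dist X (r i) (r j) <= j - i)%N.
  move=> /andP[ij jn].
  have -> : r j = (r i * \prod_(a <- take (j - i) (drop i w)) a)%g.
    by rewrite /r -{1}(subnKC ij) takeD big_cat mulgA.
  rewrite word_dist_mulr.
  apply: word_length_le; exists (take (j - i) (drop i w)); split => //.
    by move=> a /= /mem_take /mem_drop; apply: wX.
  by rewrite size_takel ?size_drop; lia.
exists r; split=> // i j ijn.
have := word_dist_tri (r i) x y; have := word_dist_tri (r j) (r i) y.
have h1 := le 0%N i; have h2 := le i j ijn; have h3 := le j n.
rewrite r0 in h1; rewrite rn in h3.
have [h1' h3'] : (word_dist X x (r i) <= i /\ word_dist X (r j) y <= n - j)%N.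
  by split; [have := h1 ltac:(lia) | have := h3 ltac:(lia)]; lia.
rewrite -/n; lia.
Qed.

Lemma word_ballE n g : word_ball X n g <-> (word_length X g <= n)%N.
Proof. by split=> [[i /= ilen ->//]|gn]; exists (word_length X g). Qed.

Lemma word_length_le1_ind (P : G -> Prop) :
  P 1%g -> (forall x s, word_length X s = 1%N -> P x -> P (x * s)%g) ->
  forall x, P x.
Proof.
move=> P1 PS x; move: {2}(word_length X x) (erefl (word_length X x)) => n.
elim: n x => [|n IH] x xn; first by rewrite (word_length_eq0 xn).
have [r [r0 rn rd]] := word_geodesic 1%g x; rewrite word_dist1 xn in rn rd.
rewrite -rn -[r n.+1](mulVKg (r n)); apply: PS.
  by rewrite -/(word_dist X (r n) (r n.+1)) rd; lia.
apply: IH; rewrite -word_dist1 -r0 rd; lia.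
Qed.

Hypothesis Xfin : finite_set X.

Lemma finite_letters : finite_set (letters X).
Proof. by rewrite finite_setU; split=> //; exact: finite_image. Qed.

Lemma finite_word_ball n : finite_set (word_ball X n).
Proof.
elim: n => [|n IH].
  apply: (@sub_finite_set _ _ [set 1%g]); last exact: finite_set1.
  by move=> g /word_ballE; rewrite leqn0 => /eqP /word_length_eq0.
apply: (@sub_finite_set _ _ (word_ball X n `|`
    [set (g * a)%g | g in word_ball X n & a in letters X])); last first.
  by rewrite finite_setU; split=> //; apply: finite_image2 => //; exact: finite_letters.
move=> g /word_ballE; rewrite leq_eqVlt ltnS => /orP[/eqP gn|/word_ballE]; last by left.
right; have := spelled_word_length g; rewrite gn => -[w [wX <- ws]] {gn}.
case/lastP: w ws wX => // w a; rewrite size_rcons => -[ws] wX.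
exists (\prod_(b <- w) b)%g; last exists a.
- apply/word_ballE/word_length_le; exists w; split=> // b bw.
  by apply: wX; rewrite /= mem_rcons inE bw orbT.
- by apply: wX; rewrite /= mem_rcons mem_head.
- by rewrite -cats1 big_cat big_seq1.
Qed.

End WordLength.

(** * Cosets of cyclic subgroups *)

Section CyclicSubgroup.
Variable G : groupType.

Lemma cyclic_subgroupM (p a b : G) :
  cyclic_subgroup p a -> cyclic_subgroup p b -> cyclic_subgroup p (a * b)%g.
Proof.
have neg m n : cyclic_subgroup p (p ^+ m * p ^- n)%g.
  case: (leqP n m) => [nm|/ltnW mn].
    by exists (m - n)%N; left; rewrite expgnFr.
  by exists (n - m)%N; right; rewrite expgnFr // invgM invgK.
have com m n : (p ^- n * p ^+ m = p ^+ m * p ^- n)%g.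
  by apply/commute_sym/commuteV/commuteX2.
case=> m [] -> [n [] ->].
- by exists (m + n)%N; left; rewrite expgnDr.
- exact: neg.
- by rewrite com; exact: neg.
- by exists (n + m)%N; right; rewrite expgnDr invgM.
Qed.

Lemma cyclic_subgroupV (p a : G) :
  cyclic_subgroup p a -> cyclic_subgroup p a^-1%g.
Proof.
by case=> m [] ->; exists m; [right|left; rewrite invgK].
Qed.

Lemma finite_index_reps (p : G) (A : set G) : finite_set A ->
  (forall x, exists2 a, A a & cyclic_subgroup p (a^-1 * x)%g) ->
  finite_index (cyclic_subgroup p).
Proof.
move=> Afin reps.
apply: (@sub_finite_set _ _
  [set [set (x * h)%g | h in cyclic_subgroup p] | x in A]); last first.
  exact: finite_image.
move=> _ /= [x _ <-]; have [a Aa pax] := reps x; exists a => //.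
apply/seteqP; split=> _ [h ph <-].
  exists ((a^-1 * x)^-1 * h)%g; last by rewrite invgM invgK mulgA mulVKg.
  by apply: cyclic_subgroupM => //; exact: cyclic_subgroupV.
exists ((a^-1 * x) * h)%g; last by rewrite !mulgA mulgV mul1g.
exact: cyclic_subgroupM.
Qed.

End CyclicSubgroup.

(* Gromov's inequality with the Gromov products doubled: [dl] is twice the usual
   constant. *)
Definition four_point (T : Type) (d : T -> T -> nat) (dl : nat) : Prop :=
  forall x y z w,
    (d x y + d z w <= maxn (d x z + d y w) (d x w + d y z) + dl)%N.

(** * Powers of an element in a hyperbolic word metric *)

Section FourPoint.
Variables (G : groupType) (Y : set G).
Hypothesis Ygen : generates Y.
Variable dl : nat.
Hypothesis hyp : four_point (word_dist Y) dl.

Local Notation d := (word_dist Y).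
Local Notation len := (word_length Y).

Lemma word_distX (g : G) i j : d (g ^+ i)%g (g ^+ (i + j))%g = len (g ^+ j)%g.
Proof. by rewrite expgnDr word_dist_mulr. Qed.

(** Apply the four-point inequality to 1, [g ^+ 2], [g] and [g ^+ n.+2]. One side of the maximum
    would make [g ^+ n.+1] shorter than [g ^+ n], against the induction hypothesis; the other side
    is the claim. *)
Lemma power_growth (g : G) : (len g + dl < len (g ^+ 2)%g)%N ->
  forall n, (len (g ^+ n)%g < len (g ^+ n.+1)%g)%N.
Proof.
move=> gg; elim=> [|n IH].
  by have := word_lengthM Ygen g g; rewrite -expg2 expg0 expg1 (word_length1 Ygen); lia.
have := hyp 1%g (g ^+ 2)%g (g ^+ 1)%g (g ^+ n.+2)%g.
rewrite !word_dist1 (word_distC Ygen (g ^+ 2)%g (g ^+ 1)%g).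
rewrite (word_distX g 1 n.+1) (word_distX g 2 n) (word_distX g 1 1) expg1.
lia.
Qed.

(* A shortest element [y] of its coset moves every power of [p] by the same
   distance [len y]; two parallel quasi-lines are uniformly close, which bounds
   [len y]. *)
Lemma virtually_cyclic_of_central (p : G) : finite_set Y ->
  (forall x, commute x p) ->
  (forall n, (len (p ^+ n)%g < len (p ^+ n.+1)%g)%N) ->
  virtually_cyclic G.
Proof.
move=> Yfin pcent incr.
have incrD k i : (len (p ^+ i)%g + k <= len (p ^+ (i + k))%g)%N.
  by elim: k => [|k IH]; [rewrite !addn0 | have := incr (i + k)%N; rewrite !addnS; lia].
exists p; set J := dl.+1.
apply: (finite_index_reps (finite_word_ball Ygen Yfin (len (p ^+ J)%g + 2 * dl))) => x.
have exP : exists n, `[< exists2 c, cyclic_subgroup p c & len (x * c)%g = n >].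
  by exists (len x); apply/asboolP; exists 1%g; [exists 0%N; left | rewrite mulg1].
case: (ex_minnP exP) => m /asboolP[c pc xc] mmin.
exists (x * c)%g; last first.
  by rewrite invgM mulgVK; exact: cyclic_subgroupV.
apply/word_ballE => //; set y := (x * c)%g in xc *.
have ymin c' : cyclic_subgroup p c' -> (len y <= len (y * c')%g)%N.
  move=> pc'; rewrite xc; apply: mmin; apply/asboolP.
  by exists (c * c')%g; [exact: cyclic_subgroupM | rewrite mulgA].
have e_pos j : d y (p ^+ j)%g = len (y * p ^- j)%g.
  rewrite /word_dist -(word_lengthV Ygen) invgM invgK.
  by congr (len _); apply/commute_sym/commuteV/commuteX/pcent.
have e_neg j : d y (p ^- j)%g = len (y * p ^+ j)%g.
  rewrite /word_dist -(word_lengthV Ygen) invgM !invgK.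
  by congr (len _); apply/commute_sym/commuteX/pcent.
(* Two sides of a maximum have to lose. Beyond the power [len y + dl], another [J = dl.+1] steps add
   more than [dl] to the length; and [n >= len y] makes [p ^+ n] at least as long as [y]. *)
pose n := (J + len y + dl)%N.
have aJ := incrD J (len y + dl)%N; have an := incrD n 0%N.
rewrite expg0 (word_length1 Ygen) !add0n in an.
have nE : n = (len y + dl + J)%N by rewrite /n; lia.
rewrite -nE in aJ.
have ep : (len (p ^+ n)%g + len y <= len (p ^+ J)%g + d y (p ^+ n)%g + dl)%N.
  have := hyp 1%g (p ^+ n)%g (p ^+ J)%g y.
  have -> : d (p ^+ n)%g (p ^+ J)%g = len (p ^+ (len y + dl))%g.
    by rewrite (word_distC Ygen) /n -addnA word_distX.
  rewrite !word_dist1 !(word_distC Ygen _ y).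
  have := ymin (p ^- J)%g (ex_intro _ J (or_intror erefl)).
  rewrite -e_pos; lia.
have en : (len (p ^+ n)%g + len y <= len (p ^+ J)%g + d y (p ^- n)%g + dl)%N.
  have := hyp 1%g (p ^- n)%g (p ^- J)%g y.
  have -> : d (p ^- n)%g (p ^- J)%g = len (p ^+ (len y + dl))%g.
    rewrite /word_dist invgK nE expgnDr mulgK //.
  rewrite !word_dist1 !(word_distC Ygen _ y) !(word_lengthV Ygen).
  have := ymin (p ^+ J)%g (ex_intro _ J (or_introl erefl)).
  rewrite -e_neg; lia.
(* In the parallelogram 1, [p ^+ n], [y * p ^+ n], [y], both diagonals exceed the long side by
   nearly [len y], so [len y] is bounded. *)
have := hyp y (p ^+ n)%g 1%g (y * p ^+ n)%g.
rewrite word_dist_mulr !word_dist1 (word_distC Ygen _ 1%g) !word_dist1.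
rewrite (word_distC Ygen (p ^+ n)%g 1%g) word_dist1 -e_neg.
have -> : d (p ^+ n)%g (y * p ^+ n)%g = len y.
  by rewrite (_ : y * p ^+ n = p ^+ n * y)%g ?word_dist_mulr //; exact/commuteX/pcent.
lia.
Qed.

End FourPoint.

(** * Small Gromov products after a bounded turn *)

Section Turning.
Variables (G : groupType) (Y : set G).
Hypotheses (Ygen : generates Y) (Yfin : finite_set Y).
Variable dl : nat.
Hypothesis hyp : four_point (word_dist Y) dl.

Local Notation d := (word_dist Y).
Local Notation len := (word_length Y).

(** [M] counts the maps from the ball of radius 1 to the ball of radius [C]. Among the [M.+1] powers
    of [g] with exponent at most [M], two conjugate the generators in the same way, and their
    quotient is central. *)
Lemma commuting_power_of_bounded_conjugates (C : nat) : exists M : nat, forall g : G,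
  (forall n x, (n <= M)%N -> (len x <= 1)%N -> (len (x ^ (g ^+ n))%g <= C)%N) ->
  exists2 e, (0 < e)%N & forall x, commute x (g ^+ e)%g.
Proof.
pose A := fset_set (word_ball Y 1); pose B := fset_set (word_ball Y C).
have inA x : (len x <= 1)%N -> x \in A.
  move=> x1; rewrite in_fset_set ?inE; first exact/word_ballE.
  exact: finite_word_ball.
have inB x : (len x <= C)%N -> x \in B.
  move=> x1; rewrite in_fset_set ?inE; first exact/word_ballE.
  exact: finite_word_ball.
have B1 : 1%g \in B by apply: inB; rewrite word_length1.
exists #|{ffun A -> B}|; set M := #|_| => g gC.
pose phi (n : 'I_M.+1) : {ffun A -> B} :=
  [ffun x => insubd [` B1]%fset (val x ^ (g ^+ n))%g].
have : ~ injective phi.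
  by move=> /leq_card; rewrite card_ord ltnn.
move=> /injectiveP/injectivePn [n [n' nn' phinn']].
have main (i j : 'I_M.+1) : (i < j)%N -> phi i = phi j ->
    exists2 e, (0 < e)%N & forall x, commute x (g ^+ e)%g.
  move=> ij phiij; exists (j - i)%N; first by rewrite subn_gt0.
  apply: (word_length_le1_ind Ygen) => [|x s s1 xg]; first exact/commute_sym/commute1.
  have sA : s \in A by apply: inA; rewrite s1.
  apply/commute_sym/commuteM; first exact/commute_sym.
  have /ffunP/(_ [` sA]%fset)/(congr1 val) := phiij.
  rewrite !ffunE /= !val_insubd !inB; try by apply: gC; rewrite ?s1 // -ltnS.
  rewrite -{1}(subnK (ltnW ij)) expgnDr conjgM => /conjg_inj/esym.
  by move=> /conjg_fixP/commgP.
case: (ltngtP n n') => [/main/(_ phinn')|/main/(_ (esym phinn'))|] //.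
by move=> /ord_inj E; rewrite E eqxx in nn'.
Qed.

(* The conclusion says that twice the Gromov product of [a] and [f h] at 1 is at
   most [N]. *)
Lemma bounded_gromov_product_turn : ~ virtually_cyclic G ->
  exists N : nat, forall a h, exists2 f, (len f <= N)%N &
    (len a + len (f * h)%g <= d a (f * h)%g + N)%N.
Proof.
(* [t] is the least length with [t + dl < 2 * t - dl], the gap that [power_growth] asks of [g]
   below. *)
move=> Gnvc; pose t := (2 * dl + 1)%N.
have [M Mpig] := commuting_power_of_bounded_conjugates (t + 4 * dl + 3).
have [K tK nK] : exists2 K, (t <= K)%N & forall n, (n <= M)%N -> (n * t <= K)%N.
  exists (M.+1 * t)%N; first by rewrite leq_pmull.
  by move=> n nM; rewrite leq_mul2r (leqW nM) orbT.
pose N := (2 * K + 10 * dl + 10)%N.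
apply: contrapT => /forallNP /(_ N) /existsNP [a /existsNP [h noturn]].
(* Without a turn, [a] has a large Gromov product with both [f * h] and [h], so by hyperbolicity
   these two have a large product with each other. *)
have {noturn} far f : (len f <= N)%N ->
    (d (f * h)%g h + N <= len (f * h)%g + len h + dl)%N.
  move=> fN; have faraway g : (len g <= N)%N ->
      (d a (g * h)%g + N < len a + len (g * h)%g)%N.
    by move=> gN; rewrite ltnNge; apply/negP => ?; apply: noturn; exists g.
  have := faraway _ fN; have := faraway 1%g.
  rewrite (word_length1 Ygen) mul1g => /(_ isT).
  have := hyp 1%g a (f * h)%g h; rewrite !word_dist1 (word_distC Ygen a h).
  lia.
have hlen : (N <= 2 * len h + dl)%N.
  by have := far 1%g; rewrite (word_length1 Ygen) mul1g word_distxx // => /(_ isT); lia.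
have [r [r0 rh rd]] := word_geodesic Ygen 1%g h; rewrite word_dist1 in rh rd.
set g := r t.
have gt : len g = t by rewrite -word_dist1 -r0 rd; lia.
have gh : d g h = (len h - t)%N by rewrite -{1}rh rd; lia.
(* Since [h] and [g * h] leave 1 in the same direction, [g * h] is longer than [h] by at least
   [t - dl]. It is at distance [len h - t] from [g ^+ 2], whose length is therefore at least
   [2 * t - dl]. *)
have g2 : (len g + dl < len (g ^+ 2)%g)%N.
  have := far g ltac:(lia); have := hyp 1%g h g (g * h)%g.
  have := word_dist_tri Ygen (g ^+ 2)%g 1%g (g * h)%g.
  have := word_dist_tri Ygen g 1%g (g * h)%g.
  rewrite expg2 word_distM gh word_dist_mulr !word_dist1.
  have := word_distC Ygen h (g * h)%g.
  have := word_distC Ygen h g.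
  lia.
have incr := power_growth Ygen hyp g2.
have gn n : (len (g ^+ n)%g <= n * t)%N.
  elim: n => [|n IH]; first by rewrite expg0 word_length1.
  rewrite expgS mulSn -gt; apply: leq_trans (word_lengthM Ygen _ _) _.
  by rewrite leq_add2l gt.
(* The powers of [g] stay close to the geodesic from 1 to [h]. *)
have near_h n : (n <= M)%N ->
    (len (g ^+ n)%g + d (g ^+ n)%g h <= len h + t + 2 * dl)%N.
  move=> nM; pose u : G := (g ^+ n)%g; pose v : G := (u^-1)%g.
  have vlen : len v = len u by exact: word_lengthV.
  have uK : (len u <= K)%N := leq_trans (gn n) (nK n nM).
  have := far v ltac:(lia).
  have vg : d v g = len (g ^+ n.+1)%g by rewrite /word_dist invgK expgSr.
  have uh : d u h = len (v * h)%g by [].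
  have vh : d v (v * h)%g = len h by rewrite word_dist_mulr.
  have := incr n.
  have := hyp 1%g (v * h)%g v h.
  have := word_distC Ygen v (v * h)%g.
  have := hyp 1%g h v g.
  have := word_distC Ygen h (v * h)%g.
  have := word_distC Ygen h g.
  have := word_distC Ygen h v.
  rewrite !word_dist1 -/u.
  lia.
(* For a short [x], both [u] and [x * u] lie near geodesics from 1 to [h] and [x * h], which run
   together this far out, and their lengths differ by at most 1. Hence they are close, which bounds
   the conjugate of [x]. *)
case: (Mpig g) => [n x nM x1|e e0 ecent].
  pose u : G := (g ^+ n)%g.
  have -> : len (x ^ (g ^+ n))%g = d u (x * u)%g by rewrite /word_dist conjgE.
  have uK : (len u <= K)%N := leq_trans (gn n) (nK n nM).
  have := near_h n nM; rewrite -/u.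
  have := far x ltac:(lia).
  have := hyp 1%g h u (x * h)%g.
  have := hyp 1%g (x * h)%g u (x * u)%g.
  have := word_distM Y x u h.
  have := word_lengthM Ygen x u.
  have := word_lengthM Ygen x h.
  have := word_lengthM Ygen x^-1%g (x * u)%g.
  have := word_lengthM Ygen x^-1%g (x * h)%g.
  rewrite !mulKg word_lengthV // !word_dist1.
  have := word_distC Ygen h (x * h)%g.
  have := word_distC Ygen h u.
  have := word_distC Ygen (x * h)%g u.
  have := word_distC Ygen (x * h)%g (x * u)%g.
  lia.
apply: Gnvc; apply: (@virtually_cyclic_of_central _ _ Ygen dl hyp (g ^+ e)%g) => // n.
rewrite -!expgnA mulnS (addnC e).
have incrD k : (len (g ^+ (e * n))%g + k <= len (g ^+ (e * n + k))%g)%N.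
  by elim: k => [|k IH]; [rewrite !addn0 | have := incr (e * n + k)%N; rewrite !addnS; lia].
by apply: leq_trans (incrD e); rewrite -addn1 leq_add2l.
Qed.

(** Elements of any length exist, since a finite group is virtually cyclic. Turning a long [h] so
    that [h * (f * h)] is almost geodesic makes the square of [h * f] nearly twice as long as [h];
    the errors add up to [4 * N + dl]. *)
Lemma exists_power_growth : ~ virtually_cyclic G ->
  exists g : G, forall n, (len (g ^+ n)%g < len (g ^+ n.+1)%g)%N.
Proof.
move=> Gnvc; have [N turn] := bounded_gromov_product_turn Gnvc.
have [h hlong] : exists h, (4 * N + dl < len h)%N.
  apply: contrapT => /forallNP short; apply: Gnvc; exists 1%g.
  apply: (finite_index_reps (finite_word_ball Ygen Yfin (4 * N + dl))) => x.
  exists x; last by exists 0%N; left; rewrite mulVg.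
  by apply/word_ballE => //; rewrite leqNgt; apply/negP/short.
have [f fN hfh] := turn h^-1%g h.
exists (h * f)%g; apply: (power_growth Ygen hyp).
have {}hfh : (len h + len (f * h)%g <= len (h * (f * h))%g + N)%N.
  by move: hfh; rewrite /word_dist invgK word_lengthV.
have : (len (h * (f * h))%g <= len ((h * f) ^+ 2)%g + len f)%N.
  rewrite -[len f](word_lengthV Ygen).
  rewrite (_ : h * (f * h) = (h * f) ^+ 2 * f^-1)%g ?word_lengthM //.
  by rewrite expg2 !mulgA mulgK.
have : (len h <= len f + len (f * h)%g)%N.
  by rewrite -(word_lengthV Ygen f) -{1}(mulKg f h) word_lengthM.
have := word_lengthM Ygen h f.
lia.
Qed.

End Turning.

(** * Elementary estimates and comparison of word metrics *)

Lemma linear_le_exp2 (a b : nat) :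
  exists l0 : nat, forall l, (l0 <= l)%N -> (a * l + b <= 2 ^ l)%N.
Proof.
exists (2 * (2 * a + b))%N => l l0l.
have k0 : (2 * a + b <= l./2)%N by lia.
apply: leq_trans (_ : 2 ^ (l./2 + l./2) <= _)%N; last by rewrite leq_exp2l //; lia.
rewrite expnD; have kexp : (l./2 < 2 ^ l./2)%N by apply: ltn_expl.
apply: leq_trans (leq_mul (ltnW kexp) kexp).
have : (l <= 2 * l./2 + 1)%N by lia.
move: (l./2) k0 => k; nia.
Qed.

(** Used to halve a path of at most [A * D] steps [l] times, at cost [e] each, while staying within
    the budget [D - B]. An [l] proportional to [D] works; the divisor [e.+1] also covers [e = 0]. *)
Lemma log2_sublinear (A B e : nat) : exists D0 : nat, forall D, (D0 < D)%N ->
  exists l, (A * D <= 2 ^ l)%N /\ (B + l * e <= D)%N.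
Proof.
have [l0 l0P] := linear_le_exp2 (A * e.+1) (A * (B + e.+1)).
exists (B + e.+1 * l0)%N => D DD0.
exists ((D - B) %/ e.+1)%N; set l := (_ %/ _)%N.
have Dl : (D - B = l * e.+1 + (D - B) %% e.+1)%N by rewrite -divn_eq.
have mod_lt : ((D - B) %% e.+1 < e.+1)%N by rewrite ltn_mod.
have ll0 : (l0 <= l)%N by rewrite leq_divRL // mulnC; lia.
split; last by nia.
apply: leq_trans (l0P _ ll0).
have DB : (D <= B + (l.+1 * e.+1))%N by rewrite mulSn; lia.
apply: leq_trans (leq_mul (leqnn A) DB) _; nia.
Qed.

Lemma finite_set_bounded (T : choiceType) (A : set T) (f : T -> nat) :
  finite_set A -> exists K : nat, forall a, A a -> (f a <= K)%N.
Proof.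
move=> /finite_fsetP[B ->]; exists (\max_(a <- B) f a)%N => a aB.
exact: leq_bigmax_seq.
Qed.

Lemma word_length_lipschitz (G : groupType) (X Y : set G) :
  generates X -> generates Y -> finite_set X ->
  exists K : nat, forall g, (word_length Y g <= K * word_length X g)%N.
Proof.
move=> Xgen Ygen Xfin.
have [K KP] := finite_set_bounded (word_length Y) (finite_letters Xfin).
exists K => g; have [w [wX <- <-]] := spelled_word_length Xgen g.
elim: w wX => [|a w IH] wX; first by rewrite big_nil word_length1.
rewrite big_cons /= mulnS; apply: leq_trans (word_lengthM Ygen _ _) _.
apply: leq_add; first by apply/KP/wX; rewrite /= mem_head.
by apply: IH => b bw; apply: wX; rewrite /= inE bw orbT.
Qed.

(** * The Morse lemma for geodesics of two word metrics *)

Section Chain.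
Variables (T : Type) (d : T -> T -> nat) (dl : nat).
Hypothesis hyp : four_point d dl.
Hypothesis dC : forall x y, d x y = d y x.
Hypothesis dxx : forall x, d x x = 0%N.

(* The Gromov product of the endpoints of a path that stays far from [w] is
   large: halving the path [l] times loses only [l * dl]. *)
Lemma gromov_chain (c : nat -> T) (w : T) (n D L : nat) :
  (forall i, (i <= n)%N -> (D <= d (c i) w)%N) ->
  (forall i, (i < n)%N -> (d (c i) (c i.+1) <= L)%N) ->
  forall l a k, (k <= 2 ^ l)%N -> (a + k <= n)%N ->
  (2 * D + d (c a) (c (a + k)%N) <= d (c a) w + d (c (a + k)%N) w + L + l * dl)%N.
Proof.
move=> far step; elim=> [|l IH] a k kl akn.
  rewrite expn0 in kl; case: k kl akn => [|[|//]] _ akn.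
    by rewrite addn0 dxx; have := far a; lia.
  rewrite addn1 in akn *.
  have := far a ltac:(lia); have := far a.+1 ltac:(lia).
  by have := step a ltac:(lia); lia.
case: (leqP k (2 ^ l)) => kl'; first by have := IH a k kl' akn; lia.
have kl2 : (k - 2 ^ l <= 2 ^ l)%N by rewrite expnS in kl; lia.
have := IH a (2 ^ l)%N (leqnn _) ltac:(lia).
have := IH (a + 2 ^ l)%N (k - 2 ^ l)%N kl2 ltac:(lia).
rewrite -addnA (subnKC (ltnW kl')).
have := hyp (c a) (c (a + k)%N) (c (a + 2 ^ l)%N) w.
have := dC (c (a + k)%N) (c (a + 2 ^ l)%N).
rewrite mulSn; lia.
Qed.

End Chain.

Section Morse.
Variables (G : groupType) (X Y : set G).
Hypotheses (Xgen : generates X) (Ygen : generates Y).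
Hypotheses (Xfin : finite_set X) (Yfin : finite_set Y).
Variable dl : nat.
Hypothesis hyp : four_point (word_dist Y) dl.

Local Notation dX := (word_dist X).
Local Notation dY := (word_dist Y).

(* The half of the Morse lemma that needs only exponential divergence: if [w] is
   a worst point, at distance [D] from [c], then walking along [c] around [w]
   takes O(D) steps at distance at least [D], so [D] = O(log D). *)
Lemma geodesic_near_geodesic : exists D0 : nat, forall (r c : nat -> G) (n m : nat),
  r 0%N = c 0%N -> r n = c m ->
  (forall i j, (i <= j <= n)%N -> dY (r i) (r j) = (j - i)%N) ->
  (forall i j, (i <= j <= m)%N -> dX (c i) (c j) = (j - i)%N) ->
  forall i, (i <= n)%N -> exists2 j, (j <= m)%N & (dY (r i) (c j) <= D0)%N.
Proof.
have [L LP] := word_length_lipschitz Xgen Ygen Xfin.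
have [K KP] := word_length_lipschitz Ygen Xgen Yfin.
(* The detour along [c] joins two points that are within [D] of points at most [4 * D] apart, whence
   [6 * D], and [K] converts this to [dX]. One step of [c] costs [L], and two final four-point
   inequalities cost [2 * dl]. *)
have [D0 D0P] := log2_sublinear (K * 6) (L + 2 * dl) dl.
exists D0 => r c n m rc0 rcn rd cd.
pose Q D := forall i, (i <= n)%N -> exists2 j, (j <= m)%N & (dY (r i) (c j) <= D)%N.
have exQ : exists D, `[< Q D >].
  exists n; apply/asboolP => i i_n; exists 0%N => //.
  by rewrite -rc0 (word_distC Ygen) rd ?subn0.
case: (ex_minnP exQ) => D /asboolP QD Dmin.
case: (leqP D D0) => [DD0 i i_n|DD0].
  by have [j jm jD] := QD i i_n; exists j => //; exact: leq_trans DD0.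
(* [D] is the least bound for this pair of geodesics, so lowering it by one is a contradiction. If
   that fails, some [r i] has all of [c] at distance at least [D]. *)
suff /asboolP/Dmin : Q D.-1 by lia.
move=> i i_n; apply: contrapT => noj.
have far j : (j <= m)%N -> (D <= dY (c j) (r i))%N.
  move=> jm; rewrite leqNgt; apply/negP => jD; apply: noj; exists j => //.
  by rewrite (word_distC Ygen); lia.
pose w := r i.
(* Go [2 * D] along [r] to either side of [w], or to the end of [r], where it meets [c]. The point
   of [c] chosen there has Gromov product at least [D] with the point of [r], seen from [w]. *)
have [j1 j1m [j1D j1w]] : exists2 j1, (j1 <= m)%N &
    (dY (r (i - 2 * D)) (c j1) <= D)%N /\
    (dY (r (i - 2 * D)) (c j1) + 2 * D <= dY (r (i - 2 * D)) w + dY (c j1) w)%N.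
  case: (leqP (2 * D) i) => iD.
    have [j jm jD] := QD (i - 2 * D)%N ltac:(lia); exists j => //; split=> //.
    by have := far j jm; rewrite /w rd; lia.
  exists 0%N => //; rewrite (_ : i - 2 * D = 0)%N; last by lia.
  rewrite -rc0 word_distxx //; split=> //.
  by have := far 0%N; rewrite -rc0 /w => /(_ isT); lia.
have [j2 j2m [j2D j2w]] : exists2 j2, (j2 <= m)%N &
    (dY (r (minn n (i + 2 * D))) (c j2) <= D)%N /\
    (dY (r (minn n (i + 2 * D))) (c j2) + 2 * D <=
      dY (r (minn n (i + 2 * D))) w + dY (c j2) w)%N.
  case: (leqP n (i + 2 * D)) => iD.
    exists m => //; rewrite rcn word_distxx //; split=> //.
    by have := far m (leqnn _); rewrite /w; lia.
  have [j jm jD] := QD (i + 2 * D)%N ltac:(lia); exists j => //; split=> //.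
  by have := far j jm; rewrite /w (word_distC Ygen (r _) (r i)) rd; lia.
have [l [lD Dl]] := D0P D DD0.
have step k : (k < m)%N -> (dY (c k) (c k.+1) <= L)%N.
  move=> km; apply: leq_trans (LP _) _.
  by rewrite -[word_length _ _]/(dX (c k) (c k.+1)) cd ?subSn // ?subnn ?muln1 //; lia.
have chain := gromov_chain hyp (word_distC Ygen) (word_distxx Ygen) far step (l := l).
set P := r (i - 2 * D)%N in j1D j1w; set R := r (minn n (i + 2 * D)) in j2D j2w.
have PR : dY P R = (dY P w + dY R w)%N.
  by rewrite (word_distC Ygen R w) /w !rd; lia.
have PR4 : (dY P R <= 4 * D)%N by rewrite rd; lia.
have dXj : (dX (c j1) (c j2) <= 2 ^ l)%N.
  apply: leq_trans (KP _) _; apply: leq_trans lD.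
  rewrite -mulnA leq_mul2l; apply/orP; right.
  rewrite -[word_length _ _]/(dY (c j1) (c j2)).
  have := word_dist_tri Ygen P (c j1) (c j2).
  have := word_dist_tri Ygen R P (c j2).
  by rewrite (word_distC Ygen (c j1) P); lia.
have jj : (2 * D + dY (c j1) (c j2) <= dY (c j1) w + dY (c j2) w + L + l * dl)%N.
  case: (leqP j1 j2) => jj.
    rewrite cd in dXj; last by lia.
    by have := chain j1 (j2 - j1)%N dXj; rewrite (subnKC jj) => /(_ j2m).
  rewrite (word_distC Xgen) cd in dXj; last by lia.
  have := chain j2 (j1 - j2)%N dXj; rewrite (subnKC (ltnW jj)) => /(_ j1m).
  by rewrite (word_distC Ygen (c j1) (c j2)) -/w; lia.
(* Passing from [P] to [R] through [c j1] and [c j2] gives them a positive Gromov product at [w],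
   but [w] lies on a geodesic between them. *)
have := hyp P R (c j1) w; have := hyp (c j1) R (c j2) w.
have := word_distC Ygen R (c j1).
have := word_distC Ygen (c j1) (c j2).
have := word_distC Ygen (c j1) R.
have := word_distC Ygen (c j2) w.
have := word_distC Ygen (c j1) w.
lia.
Qed.

(** A small product puts [w] near a point of a [dY]-geodesic, hence near a point of a [dX]-geodesic
    with the same ends; the triangle inequality in [dX] does the rest. *)
Lemma gromov_product_transfer (C : nat) : exists C' : nat, forall u v w,
  (dY u w + dY w v <= dY u v + C)%N -> (dX u w + dX w v <= dX u v + C')%N.
Proof.
have [D0 D0P] := geodesic_near_geodesic.
have [K KP] := word_length_lipschitz Ygen Xgen Yfin.
exists (2 * (K * (C + dl + D0)))%N => u v w uvw.
have [r [r0 rn rd]] := word_geodesic Ygen u v.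
have [c [c0 cm cd]] := word_geodesic Xgen u v.
set n := dY u v in uvw rn rd; set m := dX u v in cm cd *.
pose i := minn (dY u w) n.
have rc0 : r 0%N = c 0%N by rewrite r0.
have rcn : r n = c m by rewrite rn.
have [j jm jD] := D0P r c n m rc0 rcn rd cd i (geq_minr _ _).
have iw : (dY w (r i) <= C + dl)%N.
  have := hyp u v w (r i).
  have -> : dY u (r i) = i by rewrite -r0 rd; lia.
  have -> : dY v (r i) = (n - i)%N.
    by rewrite (word_distC Ygen) -{1}rn rd //; lia.
  have := word_dist_tri Ygen u v w; have := word_dist_tri Ygen v u w.
  by rewrite -/n (word_distC Ygen v w) (word_distC Ygen v u) -/n /i; lia.
have wj : (dX w (c j) <= K * (C + dl + D0))%N.
  apply: leq_trans (KP _) _; rewrite leq_mul2l; apply/orP; right.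
  rewrite -[word_length _ _]/(dY w (c j)).
  by have := word_dist_tri Ygen (r i) w (c j); lia.
have := word_dist_tri Xgen (c j) u w; have := word_dist_tri Xgen (c j) w v.
have -> : dX u (c j) = j by rewrite -c0 cd; lia.
have -> : dX (c j) v = (m - j)%N by rewrite -cm cd //; lia.
rewrite (word_distC Xgen (c j) w); lia.
Qed.

End Morse.

(** * Growth of balls and spheres *)

Section Counting.
Variables (G : groupType) (X : set G).
Hypotheses (Xgen : generates X) (Xfin : finite_set X).

Local Notation len := (word_length X).
Local Notation b := (ball_growth X).

Definition sphere_growth (n : nat) : nat := #|` fset_set (word_sphere X n)|%fset.

Local Notation s := sphere_growth.

Lemma in_ball n g : (g \in fset_set (word_ball X n)) = (len g <= n)%N.
Proof.
rewrite in_fset_set; last exact: finite_word_ball.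
by apply/idP/idP; rewrite inE => /word_ballE.
Qed.

Lemma in_sphere n g : (g \in fset_set (word_sphere X n)) = (len g == n).
Proof.
rewrite in_fset_set; first by apply/idP/idP; rewrite inE => /eqP.
apply: sub_finite_set (finite_word_ball Xgen Xfin n) => x /= xn.
by apply/word_ballE; rewrite xn.
Qed.

Lemma ball_growth_gt0 n : (0 < b n)%N.
Proof.
rewrite cardfs_gt0; apply/fset0Pn; exists 1%g.
by rewrite in_ball word_length1.
Qed.

Lemma sphere_growth_le m n : (m <= n)%N -> (s m <= b n)%N.
Proof.
move=> mn; apply/fsubset_leq_card/fsubsetP => g.
by rewrite in_sphere in_ball => /eqP ->.
Qed.

Lemma ball_growth0 : (b 0 <= s 0)%N.
Proof.
apply/fsubset_leq_card/fsubsetP => g.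
by rewrite in_sphere in_ball leqn0.
Qed.

Lemma ball_growthS n : (b n.+1 <= b n + s n.+1)%N.
Proof.
apply: leq_trans (leq_card_fsetU _ _); apply/fsubset_leq_card/fsubsetP => g.
by rewrite in_fsetU in_sphere !in_ball leq_eqVlt orbC.
Qed.

Lemma ball_growthD m n : (b (m + n) <= b m * b n)%N.
Proof.
rewrite -(size_allpairs (fun x y : G => (x * y)%g)).
apply: uniq_leq_size; first exact: fset_uniq.
move=> g; rewrite in_ball => gmn.
have [r [r0 rg rd]] := word_geodesic Xgen 1%g g; rewrite word_dist1 in rg rd.
set i := minn m (len g).
apply/allpairsP; exists (r i, ((r i)^-1 * g)%g) => /=; split.
- by rewrite in_ball -word_dist1 -r0 rd; lia.
- rewrite in_ball -[word_length _ _]/(word_dist X (r i) g).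
  by rewrite -[X in word_dist _ _ X]rg rd; lia.
- by rewrite mulVKg.
Qed.

(** Serves to replace the spheres with radii in a window of bounded width by the largest one. *)
Lemma leq_size_flatten (T : Type) (F : nat -> seq T) a q :
  exists2 i, (i <= a + q)%N &
    (size (flatten [seq F j | j <- iota a q.+1]) <= q.+1 * size (F i))%N.
Proof.
pose i : 'I_q.+1 := [arg max_(j > ord0) size (F (a + j)%N)].
have imax j : (j <= q)%N -> (size (F (a + j)%N) <= size (F (a + i)%N))%N.
  rewrite -ltnS => jq; rewrite /i; case: arg_maxnP => // k _ /(_ (Ordinal jq)).
  exact.
exists (a + i)%N; first by rewrite leq_add2l -ltnS.
rewrite size_flatten sumnE /shape -map_comp big_map.
apply: leq_trans (_ : \sum_(j <- iota a q.+1) size (F (a + i)%N) <= _)%N.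
  rewrite big_seq [X in (_ <= X)%N]big_seq; apply: leq_sum => j.
  rewrite mem_iota => /andP[aj jq] /=.
  by rewrite -{1}(subnKC aj); apply: imax; lia.
by rewrite big_const_seq count_predT size_iota iter_addn_0 mulnC.
Qed.

Lemma word_length_bounded (t : seq G) :
  exists k, forall x, x \in t -> (len x <= k)%N.
Proof.
by exists (\max_(x <- t) len x)%N => x xt; exact: leq_bigmax_seq.
Qed.

Lemma finite_index_of_linear_growth (g : G) (A : nat) :
  (forall i j, (g ^+ i)%g = (g ^+ j)%g -> i = j) ->
  (forall n, (b n <= A * n.+1)%N) -> finite_index (cyclic_subgroup g).
Proof.
move=> ginj lin; apply: contrapT => ginf.
pose R (x y : G) := cyclic_subgroup g (x^-1 * y)%g.
have Rsym x y : R x y -> R y x.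
  by move=> /cyclic_subgroupV; rewrite invgM invgK.
have indep k : exists t : seq G,
    [/\ size t = k, uniq t & forall x y, x \in t -> y \in t -> R x y -> x = y].
  elim: k => [|k [t [tk tu tR]]]; first by exists [::].
  have [x xt] : exists x, forall a, a \in t -> ~ R a x.
    apply: contrapT => /forallNP nox; apply: ginf.
    apply: (@finite_index_reps _ _ [set` t]) => // x.
    have /existsNP[a /not_implyP[at_ /contrapT Rax]] := nox x.
    by exists a.
  exists (x :: t); split => /=; first by rewrite tk.
    rewrite tu andbT; apply/negP => /xt; apply.
    by exists 0%N; left; rewrite mulVg.
  move=> u v; rewrite !inE => /orP[/eqP ->|ut] /orP[/eqP ->|vt] //.
  - by move=> /Rsym /(xt _ vt).
  - by move=> /(xt _ ut).
  - exact: tR.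
have [t [tk tu tR]] := indep (A * len g).+1.
have [r rP] := word_length_bounded t.
(* The [A * len g + 1] cosets give that many times [n.+1] elements in a ball with at most
   [A * (r + n * len g + 1)]; this [n] makes the first number larger. *)
pose n := (A * r + A)%N.
pose Z := [seq (x * g ^+ i)%g | x <- t, i <- iota 0 n.+1].
have Zu : uniq Z.
  apply: allpairs_uniq => //; first exact: iota_uniq.
  move=> _ _ /allpairsP[[x i] [xt _ ->]] /allpairsP[[y j] [yt _ ->]] /= E.
  have xy : x = y.
    apply: tR => //; rewrite /R.
    have -> : (x^-1 * y = g ^+ i * (g ^+ j)^-1)%g.
      by apply: (mulgI x); apply: (mulIg (g ^+ j)%g); rewrite mulVKg mulgA mulgVK.
    apply: cyclic_subgroupM; first by exists i; left.
    by exists j; right.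
  by rewrite xy in E *; move/mulgI/ginj : E => ->.
have gpow i : (len (g ^+ i)%g <= i * len g)%N.
  elim: i => [|i IH]; first by rewrite expg0 word_length1.
  rewrite expgS mulSn; apply: leq_trans (word_lengthM Xgen _ _) _.
  by rewrite leq_add2l.
have Zball : {subset Z <= fset_set (word_ball X (r + n * len g))}.
  move=> _ /allpairsP[[x i] [xt it ->]]; rewrite in_ball.
  apply: leq_trans (word_lengthM Xgen _ _) _; apply: leq_add; first exact: rP.
  apply: leq_trans (gpow i) _; rewrite leq_mul2r.
  by move: (it : i \in iota 0 n.+1); rewrite mem_iota add0n ltnS => /= ->; rewrite orbT.
have := uniq_leq_size Zu Zball; rewrite size_allpairs size_iota tk.
have := lin (r + n * len g)%N; rewrite -/(b _).
move=> h1 h2; have := leq_trans h2 h1; rewrite /n; nia.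
Qed.

End Counting.

(** * Supermultiplicativity of spheres up to constants *)

Section SphereProduct.
Variables (G : groupType) (X Y : set G).
Hypotheses (Xgen : generates X) (Ygen : generates Y).
Hypotheses (Xfin : finite_set X) (Yfin : finite_set Y).
Variable dl : nat.
Hypothesis hyp : four_point (word_dist Y) dl.
Hypothesis Gnvc : ~ virtually_cyclic G.

Local Notation lX := (word_length X).
Local Notation lY := (word_length Y).
Local Notation s := (sphere_growth X).

(* [g * (f * h)] determines [g] up to an element of bounded length, since [g] is
   nearly the point at distance [m] on a geodesic to it; then [f] gives [h]. *)
Lemma sphere_growth_mul : exists M K : nat, forall m n,
  exists2 i, (i <= m + n + K)%N & (s m * s n <= M * s i)%N.
Proof.
have [N turn] := bounded_gromov_product_turn Ygen Yfin hyp Gnvc.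
have [C CP] := gromov_product_transfer Xgen Ygen Xfin Yfin hyp N.
have [C2 C2P] := gromov_product_transfer Xgen Ygen Xfin Yfin hyp (N + dl).
have [L LP] := word_length_lipschitz Ygen Xgen Yfin.
pose F := fset_set (word_ball X (L * N)); pose B := fset_set (word_ball X C2).
(* The length of [g * (f * h)] lies between [m + n - (L * N + C)] and [m + n + L * N]; [q] is the
   width of this window. *)
pose q := (2 * (L * N) + C)%N.
exists (q.+1 * #|` B| * #|` F|)%N, q => m n.
pose between z g := lX g = m /\
  (word_dist Y 1%g g + word_dist Y g z <= word_dist Y 1%g z + N)%N.
pose g0 (z : G) : G := xget (1%g : G) [set g | between z g].
have g0P z g : between z g -> (lX ((g0 z)^-1 * g)%g <= C2)%N.
  move=> zg; have : between z (g0 z) by rewrite /g0; case: xgetP => // /(_ g).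
  move: (g0 z) => g' [g'm g'z]; case: zg => gm gz.
  (* Of two candidates, the one of smaller [Y]-length is almost between 1 and the other in [dY],
     hence in [dX]. Both have [X]-length [m], so they are [C2]-close. *)
  wlog ww : g g' g'm g'z gm gz / (lY g <= lY g')%N => [hw|].
    case: (leqP (lY g) (lY g')) => [|/ltnW] gg; first exact: hw.
    by rewrite -[lX _]/(word_dist X g' g) (word_distC Xgen); exact: hw.
  have := C2P 1%g g' g; rewrite !word_dist1 gm g'm.
  rewrite -[lX (_ * g)%g]/(word_dist X g' g) (word_distC Xgen g').
  have := hyp 1%g z g g'; move: g'z gz; rewrite !word_dist1.
  have := word_distC Ygen z g'; have := word_distC Ygen z g.
  move=> h0 h1 h2 h3 h4 h5.
  have h6 : (lY g + word_dist Y g g' <= lY g' + (N + dl))%N by lia.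
  by have := h5 h6; lia.
have [i iq iW] := leq_size_flatten
  (fun j => fset_set (word_sphere X j) : seq G) (m + n - (L * N + C)) q.
set W := flatten _ in iW.
exists i; first by rewrite /q in iq; lia.
rewrite -(size_allpairs pair); set P := [seq _ | _ <- _, _ <- _].
have Pu : uniq P.
  by apply: allpairs_uniq; [exact: fset_uniq | exact: fset_uniq | move=> [? ?] [? ?]].
pose rebuild (z x f : G) := ((g0 z * x)%g, (f^-1 * ((g0 z * x)^-1 * z))%g).
pose Z := [seq rebuild zx.1 zx.2 f | zx <- [seq (z, x) | z <- W, x <- B], f <- F].
have PZ : {subset P <= Z}.
  move=> _ /allpairsP[[g h] /= [gm hn ->]].
  rewrite in_sphere // in gm; rewrite in_sphere // in hn.
  have [f fN gfh] := turn g^-1%g h.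
  have fX : (lX f <= L * N)%N.
    by apply: leq_trans (LP f) _; rewrite leq_mul2l fN orbT.
  pose z : G := (g * (f * h))%g.
  have zg : (word_dist Y 1%g g + word_dist Y g z <= word_dist Y 1%g z + N)%N.
    move: gfh; rewrite word_dist_mulr !word_dist1 (word_lengthV Ygen).
    by rewrite -(word_distM Y g) mulgV word_dist1.
  have btw : between z g by split=> //; exact/eqP.
  have zlow := CP _ _ _ zg.
  rewrite word_dist_mulr !word_dist1 (eqP gm) in zlow.
  have zup := word_lengthM Xgen g (f * h)%g; rewrite -/z (eqP gm) in zup.
  have fh1 := word_lengthM Xgen f h; rewrite (eqP hn) in fh1.
  have fh2 : (n <= lX f + lX (f * h)%g)%N.
    rewrite -(eqP hn) -(word_lengthV Xgen f) -{1}(mulKg f h).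
    exact: word_lengthM.
  apply/allpairsP; exists ((z, ((g0 z)^-1 * g)%g), f) => /=; split.
  - apply/allpairsP; exists (z, ((g0 z)^-1 * g)%g) => /=; split=> //.
      apply/flattenP; exists (fset_set (word_sphere X (lX z)) : seq G).
        apply/mapP; exists (lX z) => //; rewrite mem_iota /q; lia.
      by rewrite in_sphere.
    by rewrite in_ball //; exact: g0P.
  - by rewrite in_ball.
  - by rewrite /rebuild mulVKg mulKg mulKg.
apply: leq_trans (uniq_leq_size Pu PZ) _.
rewrite !size_allpairs; apply: leq_trans (leq_mul (leq_mul iW (leqnn _)) (leqnn _)) _.
by rewrite -!mulnA leq_mul2l /= mulnC mulnA leqnn.
Qed.

(** Iterates the product estimate. The [K.+1] keeps the factor [n + K.+1] positive, so that the
    radius can later be split into that many copies of [k.+1]. *)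
Lemma sphere_growth_exp : exists M K : nat, forall k n,
  (s n ^ k.+1 <= M ^ k * ball_growth X (k.+1 * (n + K.+1)))%N.
Proof.
have [M [K MK]] := sphere_growth_mul; exists M, K => k n.
have [i ik si] : exists2 i, (i <= k.+1 * (n + K))%N & (s n ^ k.+1 <= M ^ k * s i)%N.
  elim: k => [|k [i ik si]]; first by exists n; [lia | rewrite expn1 mul1n].
  have [j ji sj] := MK n i; exists j; first by rewrite mulSn; lia.
  rewrite expnS [in X in (_ <= X)%N]expnSr -mulnA.
  apply: leq_trans (leq_mul (leqnn (M ^ k)) sj).
  by rewrite mulnCA leq_mul2l si orbT.
apply: leq_trans si _; rewrite leq_mul2l; apply/orP; right.
apply: sphere_growth_le => //; apply: leq_trans ik _.
by rewrite leq_mul2l addnS leqnSn.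
Qed.

End SphereProduct.

(** * From counting inequalities to real exponential bounds *)

Local Open Scope ring_scope.

Lemma four_point_of_gromov_hyperbolic (R : realType) (T : Type) (d : T -> T -> nat) :
  (forall x y, d x y = d y x) ->
  gromov_hyperbolic (fun x y => (d x y)%:R : R) -> exists dl, four_point d dl.
Proof.
move=> dC [delta hyp]; exists (Num.bound (2 * `|delta|)) => x y z w.
have := hyp w x y z; rewrite /gromov_product.
have := archi_boundP (mulr_ge0 (ler0n R 2) (normr_ge0 delta)).
have := ler_norm delta; rewrite addn_maxl (dC y z) => delta_le boundP hmin.
suff : ((d x y)%:R + (d z w)%:R <=
           (d x z)%:R + (d y w)%:R + (Num.bound (2 * `|delta|))%:R :> R) ||
       ((d x y)%:R + (d z w)%:R <=
           (d x w)%:R + (d z y)%:R + (Num.bound (2 * `|delta|))%:R :> R).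
  by rewrite -!natrD !ler_nat -leq_max.
move: hmin; rewrite lerBlDr ge_min => /orP[] h; apply/orP; [left|right]; lra.
Qed.

(* With [lambda = inf b(m)^(1/m)], the upper bound comes from
   [(s n / M)^m <= b (m (n + K)) <= b m ^ (n + K)] for all [m > 0]. *)
Lemma exponential_growth (R : realType) (b s : nat -> nat) (M K : nat) :
  (forall n, 0 < b n)%N ->
  (forall m n, b (m + n) <= b m * b n)%N ->
  (b 0 <= s 0)%N -> (forall n, b n.+1 <= b n + s n.+1)%N ->
  (forall k n, s n ^ k.+1 <= M ^ k * b (k.+1 * (n + K.+1)))%N ->
  ~ (exists A, forall n, b n <= A * n.+1)%N ->
  exists lambda D : R, [/\ 1 < lambda, 1 < D
    & forall n : nat,
        D^-1 * lambda ^+ n <= (b n)%:R /\ (b n)%:R <= D * lambda ^+ n].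
Proof.
move=> b_gt0 bD b0 bS sexp nonlin.
have bR_gt0 n : 0 < (b n)%:R :> R by rewrite ltr0n.
have bX n q : (b (n * q.+1) <= b n ^ q.+1)%N.
  elim: q => [|q IH]; first by rewrite muln1.
  by rewrite mulnS expnS (leq_trans (bD _ _)) // leq_mul2l IH orbT.
(* The infimum is taken on the logarithmic scale, over positive radii only. *)
pose rate := [set ln ((b n.+1)%:R : R) / n.+1%:R | n in [set: nat]].
have rate_lb : lbound rate 0.
  move=> _ [n _ <-]; apply: divr_ge0 => //; apply: ln_ge0.
  by rewrite ler1n.
have rate_inf : has_inf rate.
  by split; [exists (ln (b 1)%:R / 1%:R), 0%N | exists 0].
pose rho := inf rate; pose lambda := expR rho.
have rho_ge0 : 0 <= rho by apply: lb_le_inf => //; case: rate_inf.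
have lambda_gt0 : 0 < lambda by exact: expR_gt0.
have lower n : lambda ^+ n <= (b n)%:R.
  case: n => [|n]; first by rewrite expr0 ler1n.
  rewrite /lambda -expRM_natr -(lnK (bR_gt0 n.+1)) ler_expR -ler_pdivlMr ?ltr0n //.
  by apply: ge_inf; [case: rate_inf | exists n].
have upper n : (s n)%:R <= M.+1%:R * lambda ^+ (n + K.+1).
  have [->|s_gt0] := posnP (s n); first by rewrite mulr_ge0 ?exprn_ge0 // ltW.
  (* [M.+1] replaces [M] to have a positive divisor. *)
  pose A : R := (s n)%:R / M.+1%:R.
  have A_gt0 : 0 < A by rewrite divr_gt0 ?ltr0n.
  rewrite mulrC -ler_pdivrMr ?ltr0n // -/A -(lnK A_gt0) -expRM_natr ler_expR.
  rewrite -ler_pdivrMr ?ltr0n ?addnS //; apply: lb_le_inf; first by case: rate_inf.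
  move=> _ [m _ <-]; rewrite ler_pdivrMr ?ltr0n // mulrAC ler_pdivlMr ?ltr0n //.
  rewrite !mulr_natr -!lnXn // ler_ln ?posrE ?exprn_gt0 //.
  rewrite expr_div_n ler_pdivrMr ?exprn_gt0 ?ltr0n // -!natrX -natrM ler_nat.
  apply: leq_trans (sexp m n) _; rewrite addnS mulnC leq_mul ?bX //.
  apply: leq_trans (_ : M.+1 ^ m <= _)%N; last exact: leq_pexp2l.
  by case: (m) => // k; rewrite leq_exp2r.
(* If [lambda] were 1, [upper] would bound all spheres by [M.+1], and balls would grow linearly. *)
have lambda_gt1 : 1 < lambda.
  rewrite expR_gt1 lt_neqAle rho_ge0 andbT; apply/negP => /eqP rho0.
  apply: nonlin; exists M.+1.
  have s_le n : (s n <= M.+1)%N.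
    by have := upper n; rewrite /lambda -rho0 expR0 expr1n mulr1 ler_nat.
  elim=> [|n IH]; first by rewrite muln1 (leq_trans b0).
  by rewrite mulnS addnC (leq_trans (bS n)) // leq_add.
pose c := M.+1%:R * lambda ^+ K.+1.
have c_gt0 : 0 < c by rewrite mulr_gt0 ?ltr0n // exprn_gt0.
(* A geometric series of sphere bounds, which converges backwards because [lambda > 1]. *)
have bound n : (b n)%:R <= c * lambda ^+ n.+1 / (lambda - 1).
  have l1 : 0 < lambda - 1 by rewrite subr_gt0.
  elim: n => [|n IH].
    rewrite ler_pdivlMr //; apply: ler_pM => //; first exact: ltW.
      by apply: le_trans _ (upper 0%N); rewrite ler_nat.
    by rewrite expr1 lerBlDr lerDl.
  have -> : c * lambda ^+ n.+2 / (lambda - 1) =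
      c * lambda ^+ n.+1 / (lambda - 1) + c * lambda ^+ n.+1.
    by rewrite [lambda ^+ n.+2]exprS; field; rewrite gt_eqF.
  have := upper n.+1; rewrite addnC exprD mulrA -/c => sn.
  apply: le_trans _ (lerD IH sn).
  by rewrite -natrD ler_nat bS.
exists lambda, (c * lambda / (lambda - 1) + 1).
have D_gt0 : 0 < c * lambda / (lambda - 1).
  by apply: divr_gt0; [exact: mulr_gt0 | rewrite subr_gt0].
split=> // [|n]; first by rewrite ltrDr.
split.
  apply: le_trans (lower n); rewrite ger_pMl ?exprn_gt0 //.
  by rewrite invf_le1 ?lerDr ?ltW // addr_gt0.
apply: le_trans (bound n) _; rewrite mulrDl mul1r.
have -> : c * lambda ^+ n.+1 / (lambda - 1) =
    c * lambda / (lambda - 1) * lambda ^+ n by rewrite exprS; ring.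
by rewrite lerDl exprn_ge0 // ltW.
Qed.

Theorem theorem1 (R : realType) (G : groupType)
    (G_hyperbolic : hyperbolic_group R G)
    (G_nonelementary : ~ virtually_cyclic G)
    (X : set G) (X_finite : finite_set X) (X_generates : generates X) :
  exists lambda D : R, [/\ 1 < lambda, 1 < D
    & forall n : nat,
        D^-1 * lambda ^+ n <= (ball_growth X n)%:R
        /\ (ball_growth X n)%:R <= D * lambda ^+ n].
Proof.
have [Y [Yfin Ygen hypR]] := G_hyperbolic.
have [dl hyp] := four_point_of_gromov_hyperbolic (word_distC Ygen) hypR.
have [M [K sexp]] :=
  sphere_growth_exp X_generates Ygen X_finite Yfin hyp G_nonelementary.
apply: (@exponential_growth R _ (sphere_growth X) M K) => [|||| |].
- exact: ball_growth_gt0.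
- exact: ball_growthD.
- exact: ball_growth0.
- exact: ball_growthS.
- exact: sexp.
(* The powers of [g] have strictly increasing [Y]-length, hence are distinct, as the linear growth
   argument requires. *)
have [g incr] := exists_power_growth Ygen Yfin hyp G_nonelementary.
case=> A lin; apply: G_nonelementary; exists g.
apply: finite_index_of_linear_growth lin => // i j gij.
have mono k l : (k < l)%N -> (word_length Y (g ^+ k)%g < word_length Y (g ^+ l)%g)%N.
  elim: l => // l IH; rewrite ltnS leq_eqVlt => /orP[/eqP -> //|/IH kl].
  exact: ltn_trans kl (incr l).
by case: (ltngtP i j) => // /mono; rewrite gij ltnn.
Qed.
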